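(* Let $m$ and $n$ be two positive integers with $n\ge m$ and let $\alpha$ be a complex number with $\Re(\alpha)>-1$. Let $\widehat\rho_{j,n}^{\,m;(\alpha)}$, $0\le j\le m+n+1$, be the coefficients in the expansion $$\int_0^xL_m^{(\alpha)}(x-t)L_n^{(\alpha)}(t)\,dt=\sum_{j=0}^{m+n+1}\widehat\rho_{j,n}^{\,m;(\alpha)}L_j^{(\alpha)}(x).$$ When $n\ge m+1$, $$\widehat\rho_{j,n}^{\,m;(\alpha)}=\begin{cases}-\dfrac{(\alpha-1)_{m+n+1-j}}{(m+n+1-j)!}&\text{for } n+1\le j\le m+n+1,\\[2mm]\dfrac{(\alpha)_m}{m!}&\text{for } j=n,\\[2mm]0&\text{for } m+1\le j\le n-1\ (\text{when } n\ge m+2),\\[2mm]\dfrac{(\alpha)_{n+1}}{(n+1)!}&\text{for } j=m,\\[2mm]\dfrac{(\alpha-1)_{m+n+1-j}}{(m+n+1-j)!}&\text{for } 0\le j\le m-1.\end{cases}$$ In case $n=m$, $$\widehat\rho_{j,n}^{\,m;(\alpha)}=\begin{cases}-\dfrac{(\alpha-1)_{2m+1-j}}{(2m+1-j)!}&\text{for } m+1\le j\le 2m+1,\\[2mm]\dfrac{(\alpha)_{m+1}}{(m+1)!}+\dfrac{(\alpha)_m}{m!}&\text{for } j=m,\\[2mm]\dfrac{(\alpha-1)_{2m+1-j}}{(2m+1-j)!}&\text{for } 0\le j\le m-1.\end{cases}$$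
   Context: $(z)_0=1$ and $(z)_N=\prod_{\sigma=0}^{N-1}(z+\sigma)$ for $N\ge1$. Laguerre polynomials are normalized by $L_n^{(\alpha)}(x)=\frac{(1+\alpha)_n}{n!}\,{}_1F_1\left({-n\atop\alpha+1};x\right)=\frac{(1+\alpha)_n}{n!}\sum_{k=0}^n\frac{(-n)_k}{(\alpha+1)_k}\frac{x^k}{k!}$ for $n\ge0$. *)

(* Defs.v *)
From Stdlib Require Import Reals Factorial.
From Coquelicot Require Import Coquelicot.

Open Scope R_scope.

(* (z)_N, over Coquelicot's complex numbers. *)
Fixpoint poch (z : C) (N : nat) : C :=
  match N with
  | O => RtoC 1
  | S N' => (poch z N' * (z + RtoC (INR N')))%C
  end.

Definition factC (n : nat) : C := RtoC (INR (fact n)).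

(* [sum_n a n] is a 0 + ... + a n, i.e. it has n+1 terms.  Division is total
   in C; the denominators (alpha+1)_k do not vanish when Re alpha > -1. *)
Definition laguerre (n : nat) (alpha x : C) : C :=
  (poch (1 + alpha) n / factC n *
   sum_n (G := C_AbelianMonoid)
     (fun k : nat =>
        poch (- RtoC (INR n)) k / poch (alpha + 1) k * (x ^ k / factC k)) n)%C.

(* For every real x, the C-valued function t |-> L_m(x-t) L_n(t) of the real
   variable t is Riemann integrable from 0 to x (with orientation if x < 0),
   with integral sum_{0 <= j <= m+n+1} rho_j L_j(x).  Values rho j for
   j > m+n+1 are irrelevant. *)
Definition is_laguerre_conv_expansion
    (m n : nat) (alpha : C) (rho : nat -> C) : Prop :=
  forall x : R,
    is_RInt (V := C_R_NormedModule)
      (fun t : R =>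
         (laguerre m alpha (RtoC (x - t)) * laguerre n alpha (RtoC t))%C)
      0 x
      (sum_n (G := C_AbelianMonoid)
         (fun j : nat => (rho j * laguerre j alpha (RtoC x))%C) (m + n + 1)%nat).

(* Main.v *)
(* Write [a_k = (alpha)_k / k!] and [Q_n(x) = L_n(x) - L_{n+1}(x) + a_{n+1}],
   which is the integral of [L_n] from 0 to x.  Substituting
   [L_{m+1} = L_m + a_{m+1} - Q_m] and [L_{n+1} = L_n + a_{n+1} - Q_n] in the
   difference of convolutions [L_{m+1} * L_n - L_m * L_{n+1}] leaves
   [a_{m+1} Q_n - a_{n+1} Q_m], since [Q_m * L_n = L_m * Q_n] (integration by
   parts).  The constants cancel, so the coefficients for (m+1, n) are those for
   (m, n+1) corrected at n, n+1, m, m+1 only, and the formula follows by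
   induction on m from [L_0 * L_n = Q_n].  Uniqueness of the coefficients is
   linear independence of the [L_j], which have exact degree j. *)

Require Import Defs.
From Stdlib Require Import Reals Factorial Lia Lra.
From Coquelicot Require Import Coquelicot.

Notation is_derive_C := (is_derive (K := R_AbsRing) (V := C_R_NormedModule)).

(** * Finite sums of complex numbers *)

Definition csum (u : nat -> C) (N : nat) : C := sum_n (G := C_AbelianMonoid) u N.

Lemma csum_S (u : nat -> C) (N : nat) : csum u (S N) = (csum u N + u (S N))%C.
Proof. exact (sum_Sn (G := C_AbelianMonoid) u N). Qed.

Lemma csum_O (u : nat -> C) : csum u 0 = u 0%nat.
Proof. exact (sum_O (G := C_AbelianMonoid) u). Qed.

Lemma csum_plus (u v : nat -> C) (N : nat) :
  csum (fun k => u k + v k)%C N = (csum u N + csum v N)%C.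
Proof. exact (sum_n_plus (G := C_AbelianMonoid) u v N). Qed.

Lemma csum_mult_l (c : C) (u : nat -> C) (N : nat) :
  csum (fun k => c * u k)%C N = (c * csum u N)%C.
Proof. exact (sum_n_mult_l (K := C_Ring) c u N). Qed.

Lemma csum_mult_r (c : C) (u : nat -> C) (N : nat) :
  csum (fun k => u k * c)%C N = (csum u N * c)%C.
Proof. exact (sum_n_mult_r (K := C_Ring) c u N). Qed.

Lemma csum_zero (u : nat -> C) (N : nat) :
  (forall k, (k <= N)%nat -> u k = RtoC 0) -> csum u N = RtoC 0.
Proof.
  intros h; induction N as [|N IH].
  - rewrite csum_O; auto.
  - rewrite csum_S, IH, h by auto; ring.
Qed.

Lemma csum_single (u : nat -> C) (i N : nat) :
  (i <= N)%nat -> (forall k, (k <= N)%nat -> k <> i -> u k = RtoC 0) ->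
  csum u N = u i.
Proof.
  intros hi h; induction N as [|N IH].
  - replace i with 0%nat by lia; apply csum_O.
  - rewrite csum_S; destruct (Nat.eq_dec i (S N)) as [->|hne].
    + rewrite csum_zero; [ring|]. intros k hk; apply h; lia.
    + rewrite IH, (h (S N)); [ring|lia..|]. intros; apply h; lia.
Qed.

Lemma csum_widen (u : nat -> C) (M N : nat) :
  (M <= N)%nat -> (forall k, (M < k)%nat -> u k = RtoC 0) ->
  csum u N = csum u M.
Proof.
  intros hMN h; induction hMN as [|N hMN IH]; [reflexivity|].
  rewrite csum_S, IH, h by lia; ring.
Qed.

(** * Derivatives of complex-valued functions of a real variable *)

(** Writing f as Re f times (1, 0) plus Im f times (0, 1) makes it a sum of real functions scaling
    constant vectors, so the real sum and scaling rules suffice. *)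
Lemma is_derive_C_pair (f : R -> C) (x : R) (l : C) :
  is_derive (fun t => Re (f t)) x (Re l) ->
  is_derive (fun t => Im (f t)) x (Im l) ->
  is_derive_C f x l.
Proof.
  intros hre him.
  assert (h := is_derive_plus _ _ _ _ _
    (is_derive_scal_l (V := C_R_NormedModule) _ _ _ (1, 0) hre)
    (is_derive_scal_l (V := C_R_NormedModule) _ _ _ (0, 1) him)).
  assert (e : forall z : C, plus (scal (Re z) ((1, 0) : C_R_NormedModule))
     (scal (Im z) ((0, 1) : C_R_NormedModule)) = z).
  { intros [a b]; unfold plus, scal; simpl; unfold prod_plus, prod_scal; simpl.
    unfold plus, scal; simpl; unfold mult; simpl. f_equal; ring. }
  rewrite e in h.
  revert h; apply is_derive_ext; intros t; apply e.
Qed.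

Lemma is_derive_C_Re (f : R -> C) (x : R) (l : C) :
  is_derive_C f x l -> is_derive (fun t => Re (f t)) x (Re l).
Proof.
  intros h.
  exact (filterdiff_comp f (fun z : C_R_NormedModule => Re z) _ _ h
    (filterdiff_linear (fun z : C_R_NormedModule => Re z)
      (is_linear_fst (K := R_AbsRing) (U := R_NormedModule) (V := R_NormedModule)))).
Qed.

Lemma is_derive_C_Im (f : R -> C) (x : R) (l : C) :
  is_derive_C f x l -> is_derive (fun t => Im (f t)) x (Im l).
Proof.
  intros h.
  exact (filterdiff_comp f (fun z : C_R_NormedModule => Im z) _ _ h
    (filterdiff_linear (fun z : C_R_NormedModule => Im z)
      (is_linear_snd (K := R_AbsRing) (U := R_NormedModule) (V := R_NormedModule)))).
Qed.

Lemma is_derive_C_const (c : C) (x : R) : is_derive_C (fun _ => c) x (RtoC 0).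
Proof. exact (is_derive_const (V := C_R_NormedModule) c x). Qed.

Lemma is_derive_C_plus (f g : R -> C) (x : R) (df dg : C) :
  is_derive_C f x df -> is_derive_C g x dg ->
  is_derive_C (fun t => f t + g t)%C x (df + dg)%C.
Proof. exact (is_derive_plus (V := C_R_NormedModule) f g x df dg). Qed.

(** The derivative is taken over R while the product is that of C, so the rule is checked on real
    and imaginary parts, each a combination of real products. *)
Lemma is_derive_C_mult (f g : R -> C) (x : R) (df dg : C) :
  is_derive_C f x df -> is_derive_C g x dg ->
  is_derive_C (fun t => f t * g t)%C x (df * g x + f x * dg)%C.
Proof.
  intros hf hg.
  assert (h1 := is_derive_C_Re _ _ _ hf). assert (h2 := is_derive_C_Im _ _ _ hf).
  assert (h3 := is_derive_C_Re _ _ _ hg). assert (h4 := is_derive_C_Im _ _ _ hg).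
  assert (prod : forall u v du dv, is_derive u x du -> is_derive v x dv ->
    is_derive (fun t => u t * v t) x (du * v x + u x * dv)).
  { intros u v du dv hu hv.
    exact (is_derive_mult u v x du dv hu hv Rmult_comm). }
  apply is_derive_C_pair; simpl.
  - assert (h := is_derive_minus _ _ _ _ _ (prod _ _ _ _ h1 h3) (prod _ _ _ _ h2 h4)).
    evar_last; [exact h|]. unfold minus, plus, opp, Re, Im; simpl; ring.
  - assert (h := is_derive_plus _ _ _ _ _ (prod _ _ _ _ h1 h4) (prod _ _ _ _ h2 h3)).
    evar_last; [exact h|]. unfold minus, plus, opp, Re, Im; simpl; ring.
Qed.

Lemma is_derive_C_reflect (f : R -> C) (x t : R) (l : C) :
  is_derive_C f (x - t) l -> is_derive_C (fun s => f (x - s)) t (- l)%C.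
Proof.
  intros h.
  assert (hd : is_derive (fun s : R => x - s) t (- 1)).
  { auto_derive; auto. }
  evar_last; [exact (is_derive_comp (V := C_R_NormedModule) f _ t _ _ h hd)|].
  apply injective_projections; simpl; unfold scal; simpl; unfold mult; simpl; ring.
Qed.

Lemma is_derive_C_unique (f : R -> C) (x : R) (l l' : C) :
  is_derive_C f x l -> is_derive_C f x l' -> l = l'.
Proof.
  intros h h'; apply injective_projections.
  - transitivity (Derive (fun t => Re (f t)) x);
      [symmetry|]; apply is_derive_unique, is_derive_C_Re; assumption.
  - transitivity (Derive (fun t => Im (f t)) x);
      [symmetry|]; apply is_derive_unique, is_derive_C_Im; assumption.
Qed.

(** * Factorials and Pochhammer symbols *)

Lemma factC_neq_0 (n : nat) : factC n <> RtoC 0.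
Proof. intros h; apply RtoC_inj in h; exact (INR_fact_neq_0 n h). Qed.

Lemma RtoC_INR_S (n : nat) : RtoC (INR (S n)) = (RtoC (INR n) + 1)%C.
Proof. rewrite S_INR, RtoC_plus; reflexivity. Qed.

Lemma RtoC_INR_S_neq_0 (n : nat) : (RtoC (INR n) + 1)%C <> RtoC 0.
Proof. rewrite <- RtoC_INR_S; intros h; apply RtoC_inj in h.
  exact (not_0_INR _ (Nat.neq_succ_0 n) h). Qed.

Lemma factC_S (n : nat) : factC (S n) = ((RtoC (INR n) + 1) * factC n)%C.
Proof.
  unfold factC; rewrite <- RtoC_INR_S, <- RtoC_mult, <- mult_INR; reflexivity.
Qed.

Lemma poch_S_l (z : C) (n : nat) : poch z (S n) = (z * poch (z + 1) n)%C.
Proof.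
  induction n as [|n IH]; [simpl; ring|].
  change (poch z (S (S n))) with (poch z (S n) * (z + RtoC (INR (S n))))%C.
  rewrite IH, RtoC_INR_S; simpl; ring.
Qed.

Lemma poch_neq_0 (z : C) (n : nat) :
  (forall k, (k < n)%nat -> (z + RtoC (INR k))%C <> RtoC 0) -> poch z n <> RtoC 0.
Proof.
  intros h; induction n as [|n IH]; simpl.
  - intros e; apply RtoC_inj in e; lra.
  - apply Cmult_neq_0; auto.
Qed.

(** The factor with sigma = n is zero. This terminates the hypergeometric series of L_n at degree
    n. *)
Lemma poch_opp_INR_zero (n k : nat) :
  (n < k)%nat -> poch (- RtoC (INR n)) k = RtoC 0.
Proof.
  intros h; induction h as [|k h IH]; simpl; [|rewrite IH]; ring.
Qed.

Lemma poch_opp_INR_neq_0 (n : nat) : poch (- RtoC (INR n)) n <> RtoC 0.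
Proof.
  apply poch_neq_0; intros k hk e.
  apply lt_INR in hk. apply (f_equal Re) in e; simpl in e; lra.
Qed.

(** This is where Re alpha > -1 enters: the real part is positive, hence no denominator (alpha +
    1)_k vanishes. *)
Lemma Re_gt_m1_neq_0 (alpha : C) (k : nat) :
  -1 < Re alpha -> (alpha + 1 + RtoC (INR k))%C <> RtoC 0.
Proof.
  intros h e; apply (f_equal Re) in e.
  assert (hk := pos_INR k). unfold Re in *; simpl in e; lra.
Qed.

(** * Polynomials in the basis x^k / k! *)

(** In this basis differentiation is just a shift of the coefficient sequence. *)
Definition exp_poly (c : nat -> C) (N : nat) (x : C) : C :=
  csum (fun k => c k * (x ^ k / factC k))%C N.

Lemma is_derive_C_exp_monomial (k : nat) (t : R) :
  is_derive_C (fun s => RtoC s ^ S k / factC (S k))%C t (RtoC t ^ k / factC k)%C.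
Proof.
  assert (hd : is_derive (fun s : R => s ^ S k) t (INR (S k) * t ^ k)).
  { evar_last; [exact (is_derive_pow (fun s => s) (S k) t 1 (is_derive_id t))|].
    rewrite Rmult_1_r; reflexivity. }
  assert (hC : is_derive_C (fun s => RtoC s ^ S k)%C t (RtoC (INR (S k) * t ^ k))).
  (* On the real line the power is real, so its imaginary part is the constant 0. *)
  { apply is_derive_C_pair.
    - revert hd; apply is_derive_ext; intros s; rewrite <- RtoC_pow; reflexivity.
    - apply (is_derive_ext (fun _ => 0)); [|exact (is_derive_const 0 t)].
      intros s; rewrite <- RtoC_pow; reflexivity. }
  evar_last; [exact (is_derive_C_mult _ _ _ _ _ hC (is_derive_C_const _ t))|].
  cbv beta; rewrite RtoC_mult, factC_S, RtoC_pow, RtoC_INR_S. field.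
  split; [apply factC_neq_0|apply RtoC_INR_S_neq_0].
Qed.

Lemma is_derive_C_exp_poly (c : nat -> C) (N : nat) (t : R) :
  is_derive_C (fun s => exp_poly c (S N) (RtoC s)) t
    (exp_poly (fun k => c (S k)) N (RtoC t)).
Proof.
  assert (term : forall k, is_derive_C
    (fun s => c (S k) * (RtoC s ^ S k / factC (S k)))%C t
    (c (S k) * (RtoC t ^ k / factC k))%C).
  { intros k. evar_last.
    - exact (is_derive_C_mult _ _ _ _ _ (is_derive_C_const _ t)
        (is_derive_C_exp_monomial k t)).
    - simpl; ring. }
  induction N as [|N IH].
  - unfold exp_poly at 2; rewrite csum_O.
    evar_last.
    + apply (is_derive_ext (V := C_R_NormedModule)
        (fun s => c 0%nat * (1 / factC 0) + c 1%nat * (RtoC s ^ 1 / factC 1))%C).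
      { intros s; unfold exp_poly; rewrite csum_S, csum_O; reflexivity. }
      exact (is_derive_C_plus _ _ _ _ _ (is_derive_C_const _ t) (term 0%nat)).
    + simpl; ring.
  - unfold exp_poly at 2; rewrite csum_S.
    apply (is_derive_ext (V := C_R_NormedModule)
      (fun s => exp_poly c (S N) (RtoC s)
         + c (S (S N)) * (RtoC s ^ S (S N) / factC (S (S N))))%C).
    { intros s; unfold exp_poly; rewrite (csum_S _ (S N)); reflexivity. }
    exact (is_derive_C_plus _ _ _ _ _ IH (term (S N))).
Qed.

Lemma exp_poly_0 (c : nat -> C) (N : nat) : exp_poly c N (RtoC 0) = c 0%nat.
Proof.
  unfold exp_poly; rewrite (csum_single _ 0); [|lia|].
  - simpl; unfold factC; simpl; field.
  - intros [|k] _ hk; [lia|]. simpl; unfold Cdiv; ring.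
Qed.

(** The value at 0 gives the coefficient of index 0. The derivative of the zero function is zero and
    has the shifted coefficients, so induction on [N] reaches the others. *)
Lemma exp_poly_eq_0 (c : nat -> C) (N : nat) :
  (forall x : R, exp_poly c N (RtoC x) = RtoC 0) ->
  forall k, (k <= N)%nat -> c k = RtoC 0.
Proof.
  revert c; induction N as [|N IH]; intros c h [|k] hk;
    try (rewrite <- (exp_poly_0 c 0); apply h);
    try (rewrite <- (exp_poly_0 c (S N)); apply h); [lia|].
  apply (IH (fun i => c (S i))); [|lia].
  intros x. eapply is_derive_C_unique; [apply is_derive_C_exp_poly|].
  apply (is_derive_ext (V := C_R_NormedModule) (fun _ => RtoC 0)).
  - intros t; symmetry; apply h.
  - apply is_derive_C_const.
Qed.

(** * Coefficients of the Laguerre polynomials *)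

Definition laguerre_coef (alpha : C) (n k : nat) : C :=
  (poch (1 + alpha) n / factC n * (poch (- RtoC (INR n)) k / poch (alpha + 1) k))%C.

(** Coefficients with k > n vanish, so the bound [N] is free. This lets polynomials of different
    degrees be added under one sum. *)
Lemma laguerre_exp_poly (alpha x : C) (n N : nat) :
  (n <= N)%nat -> laguerre n alpha x = exp_poly (laguerre_coef alpha n) N x.
Proof.
  intros hN; unfold exp_poly; rewrite (csum_widen _ n N hN).
  - unfold laguerre, laguerre_coef; fold (csum (fun k =>
      poch (- RtoC (INR n)) k / poch (alpha + 1) k * (x ^ k / factC k))%C n).
    rewrite <- csum_mult_l.
    apply (sum_n_ext (G := C_AbelianMonoid)); intros k; simpl; ring.
  - intros k hk; unfold laguerre_coef; rewrite poch_opp_INR_zero by exact hk.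
    unfold Cdiv; ring.
Qed.

(** Coefficient form of (L_n - L_{n+1})' = L_n. After (-n-1)_{k+1} = -(n+1) (-n)_k and removal of
    common factors, it reduces to (k - n) + (1 + alpha + n) = alpha + 1 + k. *)
Lemma laguerre_coef_S (alpha : C) (n k : nat) :
  -1 < Re alpha ->
  (laguerre_coef alpha n (S k) - laguerre_coef alpha (S n) (S k))%C
  = laguerre_coef alpha n k.
Proof.
  intros h; unfold laguerre_coef.
  rewrite (poch_S_l (- RtoC (INR (S n)))), RtoC_INR_S, factC_S.
  replace (- (RtoC (INR n) + 1) + 1)%C with (- RtoC (INR n))%C by ring.
  change (poch (- RtoC (INR n)) (S k))
    with (poch (- RtoC (INR n)) k * (- RtoC (INR n) + RtoC (INR k)))%C.
  change (poch (alpha + 1) (S k))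
    with (poch (alpha + 1) k * (alpha + 1 + RtoC (INR k)))%C.
  change (poch (1 + alpha) (S n))
    with (poch (1 + alpha) n * (1 + alpha + RtoC (INR n)))%C.
  assert (hk := Re_gt_m1_neq_0 alpha k h).
  assert (hn := RtoC_INR_S_neq_0 n).
  assert (hf := factC_neq_0 n).
  assert (hp : poch (alpha + 1) k <> RtoC 0).
  { apply poch_neq_0; intros; apply Re_gt_m1_neq_0, h. }
  field; auto.
Qed.

(** The two factors (1 + alpha)_n cancel, leaving (-n)_n / n!. *)
Lemma laguerre_coef_diag_neq_0 (alpha : C) (n : nat) :
  -1 < Re alpha -> laguerre_coef alpha n n <> RtoC 0.
Proof.
  intros h; unfold laguerre_coef.
  assert (hp : poch (alpha + 1) n <> RtoC 0).
  { apply poch_neq_0; intros; apply Re_gt_m1_neq_0, h. }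
  rewrite (Cplus_comm 1 alpha).
  replace (poch (alpha + 1) n / factC n
      * (poch (- RtoC (INR n)) n / poch (alpha + 1) n))%C
    with (poch (- RtoC (INR n)) n * / factC n)%C.
  - apply Cmult_neq_0; [apply poch_opp_INR_neq_0|].
    intros e; apply (factC_neq_0 n).
    assert (e' : (factC n * / factC n)%C = RtoC 1) by (apply Cinv_r, factC_neq_0).
    rewrite e, Cmult_0_r in e'; apply RtoC_inj in e'; lra.
  - field; split; [exact hp|apply factC_neq_0].
Qed.

(** * The numbers (z)_k / k! and the antiderivative of L_n *)

(** This is the coefficient of t^k in (1 - t)^(-z); for z = alpha it is the number a_k. *)
Definition binom_coef (z : C) (k : nat) : C := (poch z k / factC k)%C.

(** Coefficient form of (1 - t)^(1 - z) = (1 - t) (1 - t)^(-z). It links the values at alpha - 1 in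
    the theorem to those at alpha. *)
Lemma binom_coef_pascal (z : C) (k : nat) :
  binom_coef (z - 1) (S k) = (binom_coef z (S k) - binom_coef z k)%C.
Proof.
  unfold binom_coef; rewrite factC_S, poch_S_l.
  replace (z - 1 + 1)%C with z by ring.
  change (poch z (S k)) with (poch z k * (z + RtoC (INR k)))%C.
  field; split; [apply factC_neq_0|apply RtoC_INR_S_neq_0].
Qed.

Definition laguerre_prim (n : nat) (alpha x : C) : C :=
  (laguerre n alpha x - laguerre (S n) alpha x + binom_coef alpha (S n))%C.

(** Since L_n(0) = (1 + alpha)_n / n!, the difference L_n(0) - L_{n+1}(0) is -a_{n+1}, which the
    added constant compensates. *)
Lemma laguerre_prim_0 (n : nat) (alpha : C) :
  laguerre_prim n alpha (RtoC 0) = RtoC 0.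
Proof.
  unfold laguerre_prim; rewrite !(laguerre_exp_poly _ _ _ (S n)) by lia.
  rewrite !exp_poly_0; unfold laguerre_coef, binom_coef; simpl poch at 2 3 5 6.
  rewrite (poch_S_l alpha), (Cplus_comm alpha 1), factC_S; simpl.
  field; split; [apply factC_neq_0|apply RtoC_INR_S_neq_0].
Qed.

Lemma is_derive_laguerre_prim (n : nat) (alpha : C) (t : R) :
  -1 < Re alpha ->
  is_derive_C (fun s => laguerre_prim n alpha (RtoC s)) t
    (laguerre n alpha (RtoC t)).
Proof.
  intros h.
  evar_last.
  (* The difference is written with [(- 1) *] so that [csum_plus] and [csum_mult_l] can split it;
     the same form recurs below. *)
  - apply (is_derive_ext (V := C_R_NormedModule) (fun s =>
      exp_poly (fun k => laguerre_coef alpha n k + (- 1) * laguerre_coef alpha (S n) k)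
        (S n) (RtoC s) + binom_coef alpha (S n))%C).
    2: exact (is_derive_C_plus _ _ _ _ _ (is_derive_C_exp_poly _ n t)
        (is_derive_C_const _ t)).
    intros s; unfold laguerre_prim.
    rewrite !(laguerre_exp_poly _ _ _ (S n)) by lia; unfold exp_poly.
    f_equal.
    transitivity (csum (fun k => laguerre_coef alpha n k * (RtoC s ^ k / factC k)) (S n)
      + csum (fun k => (-1) * (laguerre_coef alpha (S n) k * (RtoC s ^ k / factC k))) (S n))%C.
    + rewrite <- csum_plus; apply (sum_n_ext (G := C_AbelianMonoid)); intros k; simpl; ring.
    + rewrite csum_mult_l; ring.
  - rewrite (laguerre_exp_poly _ _ _ n) by lia.
    rewrite Cplus_0_r; unfold exp_poly.
    apply (sum_n_ext (G := C_AbelianMonoid)); intros k.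
    rewrite <- (laguerre_coef_S alpha n k h). cbv beta; f_equal; ring.
Qed.

Lemma ex_derive_laguerre (n : nat) (alpha : C) (t : R) :
  exists l, is_derive_C (fun s => laguerre n alpha (RtoC s)) t l.
Proof.
  (* The bound is padded from [n] to [S n] because [is_derive_C_exp_poly] differentiates sums with a
     successor bound. *)
  eexists; apply (is_derive_ext (V := C_R_NormedModule)
    (fun s => exp_poly (laguerre_coef alpha n) (S n) (RtoC s))).
  - intros s; symmetry; apply laguerre_exp_poly; lia.
  - apply is_derive_C_exp_poly.
Qed.

(** * Comparison of the convolutions for (m+1, n) and (m, n+1) *)

(** Integration by parts is absorbed into one explicit antiderivative [F]: its product term
    differentiates to L_m(x - t) Q_n(t) - Q_m(x - t) L_n(t), and its other two terms to a_{m+1}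
    L_n(t) - a_{n+1} L_m(x - t). *)
Lemma is_RInt_laguerre_conv_step (m n : nat) (alpha : C) (x : R) :
  -1 < Re alpha ->
  is_RInt (V := C_R_NormedModule)
    (fun t => laguerre (S m) alpha (RtoC (x - t)) * laguerre n alpha (RtoC t)
       - laguerre m alpha (RtoC (x - t)) * laguerre (S n) alpha (RtoC t))%C
    0 x
    (binom_coef alpha (S m) * laguerre_prim n alpha (RtoC x)
     - binom_coef alpha (S n) * laguerre_prim m alpha (RtoC x))%C.
Proof.
  intros h.
  (* The product [Q_m(x - t) Q_n(t)] vanishes at t = 0 and t = x. *)
  set (F := fun t : R => (binom_coef alpha (S m) * laguerre_prim n alpha (RtoC t)
     + (binom_coef alpha (S n) * laguerre_prim m alpha (RtoC (x - t))
     + (- 1) * (laguerre_prim m alpha (RtoC (x - t)) * laguerre_prim n alpha (RtoC t))))%C).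
  evar_last.
  - apply (is_RInt_derive (V := C_R_CompleteNormedModule) F).
    + intros t _.
      assert (hn := is_derive_laguerre_prim n alpha t h).
      assert (hm := is_derive_C_reflect _ x t _ (is_derive_laguerre_prim m alpha (x - t) h)).
      assert (hF := is_derive_C_plus _ _ _ _ _
        (is_derive_C_mult _ _ _ _ _ (is_derive_C_const (binom_coef alpha (S m)) t) hn)
        (is_derive_C_plus _ _ _ _ _
          (is_derive_C_mult _ _ _ _ _ (is_derive_C_const (binom_coef alpha (S n)) t) hm)
          (is_derive_C_mult _ _ _ _ _ (is_derive_C_const (-1)%C t)
            (is_derive_C_mult _ _ _ _ _ hm hn)))).
      evar_last; [exact hF|]. cbv beta; unfold laguerre_prim; ring.
    + intros t _.
      apply (ex_derive_continuous (V := C_R_NormedModule)).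
      destruct (ex_derive_laguerre n alpha t) as [l1 h1].
      destruct (ex_derive_laguerre (S n) alpha t) as [l2 h2].
      destruct (ex_derive_laguerre m alpha (x - t)) as [l3 h3].
      destruct (ex_derive_laguerre (S m) alpha (x - t)) as [l4 h4].
      apply is_derive_C_reflect in h3; apply is_derive_C_reflect in h4.
      assert (hF := is_derive_C_plus _ _ _ _ _ (is_derive_C_mult _ _ _ _ _ h4 h1)
        (is_derive_C_mult _ _ _ _ _ (is_derive_C_const (-1)%C t)
          (is_derive_C_mult _ _ _ _ _ h3 h2))).
      eexists; eapply (is_derive_ext (V := C_R_NormedModule)); [|exact hF].
      intros s; simpl; ring.
  - unfold F; change (@minus C_R_CompleteNormedModule) with Cminus.
    replace (x - x) with 0 by ring; rewrite Rminus_0_r, !laguerre_prim_0; ring.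
Qed.

(** * The closed form of the coefficients *)

Definition kronecker (i j : nat) : C := if (i =? j)%nat then RtoC 1 else RtoC 0.

Lemma csum_kronecker (f : nat -> C) (i N : nat) :
  (i <= N)%nat -> csum (fun j => kronecker i j * f j)%C N = f i.
Proof.
  intros hi; rewrite (csum_single _ i N hi).
  - unfold kronecker; rewrite Nat.eqb_refl; ring.
  - intros k _ hk; unfold kronecker.
    destruct (Nat.eqb_spec i k); [congruence|ring].
Qed.

Ltac decide_comparisons :=
  repeat match goal with
    | |- context [(?a <? ?b)%nat] => destruct (Nat.ltb_spec a b); try lia
    | |- context [(?a =? ?b)%nat] => destruct (Nat.eqb_spec a b); try lia
    end.

(* All five cases of the theorem added up, so that the case n = m and the
   pairs with n < m met in the induction need no separate treatment. *)
Definition conv_coef (alpha : C) (m n j : nat) : C :=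
  ((if (n <? j)%nat then - binom_coef (alpha - 1) (m + n + 1 - j) else RtoC 0)
   + binom_coef alpha m * kronecker n j
   + binom_coef alpha (S n) * kronecker m j
   + (if (j <? m)%nat then binom_coef (alpha - 1) (m + n + 1 - j) else RtoC 0))%C.

Lemma binom_coef_0 (z : C) : binom_coef z 0 = RtoC 1.
Proof. unfold binom_coef, factC; simpl; field. Qed.

(** The right side lists the coefficients of Q_n. Under the bound, n < j leaves only j = n + 1,
    where the index of [binom_coef] is 0; past it, truncated subtraction would still give -1 on the
    left. *)
Lemma conv_coef_0_l (alpha : C) (n j : nat) :
  (j <= n + 1)%nat ->
  conv_coef alpha 0 n j = (kronecker n j + (- 1) * kronecker (S n) j
    + binom_coef alpha (S n) * kronecker 0 j)%C.
Proof.
  intros hj; unfold conv_coef, kronecker.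
  rewrite binom_coef_0; change (j <? 0)%nat with false.
  destruct (Nat.ltb_spec n j) as [h|h];
    destruct (Nat.eqb_spec (S n) j) as [e|e]; try lia; [|ring].
  replace (0 + n + 1 - j)%nat with 0%nat by lia; rewrite binom_coef_0; ring.
Qed.

(** Both index pairs have the same sum, so the outer ranges carry the same values. Only j = n + 1
    joins the upper range and j = m the lower one, and there Pascal's rule reconciles the two
    sides. *)
Lemma conv_coef_S_l (alpha : C) (m n j : nat) :
  (j <= m + n + 2)%nat ->
  conv_coef alpha (S m) n j =
    (conv_coef alpha m (S n) j
     + (binom_coef alpha (S m) * (kronecker n j + (- 1) * kronecker (S n) j)
     + (- binom_coef alpha (S n)) * (kronecker m j + (- 1) * kronecker (S m) j)))%C.
Proof.
  intros hj; unfold conv_coef, kronecker.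
  replace (S m + n + 1 - j)%nat with (m + S n + 1 - j)%nat by lia.
  (* The guards keep [h1] and [h2] from rewriting except in the branches where j is the boundary
     index concerned. *)
  assert (h1 : j = S n -> binom_coef (alpha - 1) (m + S n + 1 - j)
                = (binom_coef alpha (S m) - binom_coef alpha m)%C).
  { intros ->; replace (m + S n + 1 - S n)%nat with (S m) by lia.
    apply binom_coef_pascal. }
  assert (h2 : j = m -> binom_coef (alpha - 1) (m + S n + 1 - j)
                = (binom_coef alpha (S (S n)) - binom_coef alpha (S n))%C).
  { intros ->; replace (m + S n + 1 - m)%nat with (S (S n)) by lia.
    apply binom_coef_pascal. }
  decide_comparisons;
  rewrite ?h1 by lia; rewrite ?h2 by lia; subst; try ring.
Qed.

Lemma laguerre_0 (alpha x : C) : laguerre 0 alpha x = RtoC 1.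
Proof.
  rewrite (laguerre_exp_poly _ _ 0 0) by lia.
  unfold exp_poly; rewrite csum_O; unfold laguerre_coef, factC; simpl; field.
Qed.

Lemma conv_coef_expansion (m n : nat) (alpha : C) :
  -1 < Re alpha -> is_laguerre_conv_expansion m n alpha (conv_coef alpha m n).
Proof.
  (* [n] stays general because the case (m+1, n) appeals to (m, n+1). *)
  intros h; revert n; induction m as [|m IH]; intros n x.
  - evar_last.
    + apply (is_RInt_ext (V := C_R_NormedModule) (fun t => laguerre n alpha (RtoC t))).
      { intros t _; rewrite laguerre_0; symmetry; apply Cmult_1_l. }
      apply (is_RInt_derive (V := C_R_CompleteNormedModule)
        (fun t => laguerre_prim n alpha (RtoC t))).
      * intros t _; apply is_derive_laguerre_prim, h.
      * intros t _; apply (ex_derive_continuous (V := C_R_NormedModule)).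
        apply ex_derive_laguerre.
    + change (@minus C_R_CompleteNormedModule) with Cminus.
      rewrite laguerre_prim_0; symmetry.
      fold (csum (fun j => conv_coef alpha 0 n j * laguerre j alpha (RtoC x))%C (0 + n + 1)).
      transitivity (csum (fun j =>
          kronecker n j * laguerre j alpha (RtoC x)
          + ((- 1) * (kronecker (S n) j * laguerre j alpha (RtoC x))
          + binom_coef alpha (S n) * (kronecker 0 j * laguerre j alpha (RtoC x))))
          (0 + n + 1))%C.
      { apply (sum_n_ext_loc (G := C_AbelianMonoid)); intros j hj.
        rewrite conv_coef_0_l by lia; simpl; ring. }
      rewrite !csum_plus, !csum_mult_l, !csum_kronecker by lia.
      (* The constant a_{n+1} of Q_n is the coefficient of L_0 = 1. *)
      rewrite laguerre_0; unfold laguerre_prim; ring.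
  - evar_last.
    (* The term L_m(x - t) L_{n+1}(t) of the induction hypothesis cancels against the step, leaving
       L_{m+1}(x - t) L_n(t). *)
    + assert (hI := is_RInt_plus (V := C_R_NormedModule) _ _ _ _ _ _
        (IH (S n) x) (is_RInt_laguerre_conv_step m n alpha x h)).
      revert hI; apply is_RInt_ext; intros t _.
      change (@plus C_R_NormedModule) with Cplus; simpl; ring.
    + change (@plus C_R_NormedModule) with Cplus.
      fold (csum (fun j => conv_coef alpha m (S n) j * laguerre j alpha (RtoC x))%C (m + S n + 1)).
      fold (csum (fun j => conv_coef alpha (S m) n j * laguerre j alpha (RtoC x))%C (S m + n + 1)).
      symmetry; replace (S m + n + 1)%nat with (m + S n + 1)%nat by lia.
      transitivity (csum (fun j =>
          conv_coef alpha m (S n) j * laguerre j alpha (RtoC x)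
          + (binom_coef alpha (S m) * (kronecker n j * laguerre j alpha (RtoC x)
              + (- 1) * (kronecker (S n) j * laguerre j alpha (RtoC x)))
          + (- binom_coef alpha (S n)) * (kronecker m j * laguerre j alpha (RtoC x)
              + (- 1) * (kronecker (S m) j * laguerre j alpha (RtoC x)))))
          (m + S n + 1))%C.
      { apply (sum_n_ext_loc (G := C_AbelianMonoid)); intros j hj.
        rewrite conv_coef_S_l by lia; simpl; ring. }
      rewrite !csum_plus, !csum_mult_l, !csum_plus, !csum_mult_l, !csum_kronecker by lia.
      unfold laguerre_prim; ring.
Qed.

(** * Linear independence and uniqueness of the expansion *)

(** Only L_N reaches degree N, so the coefficient of x^N / N! in the combination is [r N] times a
    nonzero number. *)
Lemma laguerre_comb_last_coef (alpha : C) (r : nat -> C) (N : nat) :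
  -1 < Re alpha ->
  (forall x : R, csum (fun j => r j * laguerre j alpha (RtoC x))%C N = RtoC 0) ->
  r N = RtoC 0.
Proof.
  intros h hr.
  assert (hc : csum (fun j => r j * laguerre_coef alpha j N)%C N = RtoC 0).
  { apply (exp_poly_eq_0 (fun k => csum (fun j => r j * laguerre_coef alpha j k)%C N) N);
      [|lia].
    intros x; rewrite <- (hr x); unfold exp_poly, csum.
    transitivity (csum (fun k => csum (fun j =>
      r j * laguerre_coef alpha j k * (RtoC x ^ k / factC k)) N) N)%C.
    - apply (sum_n_ext (G := C_AbelianMonoid)); intros k; symmetry; apply csum_mult_r.
    (* Exchanging the sums passes from grouping by powers of x to grouping by Laguerre
       polynomials. *)
    - unfold csum; rewrite sum_n_switch.
      apply (sum_n_ext_loc (G := C_AbelianMonoid)); intros j hj.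
      rewrite (laguerre_exp_poly _ _ j N hj); unfold exp_poly.
      rewrite <- csum_mult_l.
      apply (sum_n_ext (G := C_AbelianMonoid)); intros k; simpl; ring. }
  rewrite (csum_single _ N) in hc; [|lia|].
  - destruct (Ceq_dec (r N) (RtoC 0)) as [e|e]; [exact e|].
    destruct (Cmult_neq_0 _ _ e (laguerre_coef_diag_neq_0 alpha N h) hc).
  - intros j hj hne; unfold laguerre_coef.
    rewrite poch_opp_INR_zero by lia; unfold Cdiv; ring.
Qed.

(** Descent on the top index: once the last coefficient is zero, the sum shortens by one term. *)
Lemma laguerre_lin_indep (alpha : C) (r : nat -> C) (N : nat) :
  -1 < Re alpha ->
  (forall x : R, csum (fun j => r j * laguerre j alpha (RtoC x))%C N = RtoC 0) ->
  forall j, (j <= N)%nat -> r j = RtoC 0.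
Proof.
  intros h; induction N as [|N IH]; intros hr j hj;
    assert (hlast := laguerre_comb_last_coef alpha r _ h hr).
  - replace j with 0%nat by lia; exact hlast.
  - destruct (Nat.eq_dec j (S N)) as [->|hne]; [exact hlast|].
    apply IH; [|lia].
    intros x; rewrite <- (hr x), csum_S, hlast; ring.
Qed.

Lemma expansion_unique (m n : nat) (alpha : C) (rho rho' : nat -> C) :
  -1 < Re alpha ->
  is_laguerre_conv_expansion m n alpha rho ->
  is_laguerre_conv_expansion m n alpha rho' ->
  forall j, (j <= m + n + 1)%nat -> rho j = rho' j.
Proof.
  intros h hrho hrho' j hj.
  assert (e : (rho j + (- 1) * rho' j)%C = RtoC 0).
  { apply (laguerre_lin_indep alpha (fun j => rho j + (- 1) * rho' j)%C (m + n + 1) h);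
      [|exact hj].
    intros x.
    (* Both expansions equal the same integral at each real x, so their difference is a vanishing
       combination. *)
    assert (e1 := is_RInt_unique (V := C_R_CompleteNormedModule) _ _ _ _ (hrho x)).
    assert (e2 := is_RInt_unique (V := C_R_CompleteNormedModule) _ _ _ _ (hrho' x)).
    rewrite e1 in e2.
    change (csum (fun j => rho j * laguerre j alpha (RtoC x))%C (m + n + 1)
      = csum (fun j => rho' j * laguerre j alpha (RtoC x))%C (m + n + 1)) in e2.
    transitivity (csum (fun j => rho j * laguerre j alpha (RtoC x)
      + (- 1) * (rho' j * laguerre j alpha (RtoC x)))%C (m + n + 1)).
    - apply (sum_n_ext (G := C_AbelianMonoid)); intros k; simpl; ring.
    - rewrite csum_plus, csum_mult_l, e2; ring. }
  replace (rho j) with (rho j + (- 1) * rho' j + rho' j)%C by ring.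
  rewrite e; ring.
Qed.

Theorem theorem4p1 (m n : nat) (alpha : C)
    (hm : (1 <= m)%nat) (hmn : (m <= n)%nat) (halpha : (-1 < Re alpha)%R) :
  (exists rho : nat -> C, is_laguerre_conv_expansion m n alpha rho) /\
  (forall rho : nat -> C, is_laguerre_conv_expansion m n alpha rho ->
    ((m + 1 <= n)%nat ->
      (forall j : nat, (n + 1 <= j <= m + n + 1)%nat ->
         rho j = (- (poch (alpha - 1) (m + n + 1 - j) / factC (m + n + 1 - j)))%C) /\
      rho n = (poch alpha m / factC m)%C /\
      (forall j : nat, (m + 1 <= j <= n - 1)%nat -> rho j = RtoC 0) /\
      rho m = (poch alpha (n + 1) / factC (n + 1))%C /\
      (forall j : nat, (j <= m - 1)%nat ->
         rho j = (poch (alpha - 1) (m + n + 1 - j) / factC (m + n + 1 - j))%C))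
    /\
    (n = m ->
      (forall j : nat, (m + 1 <= j <= 2 * m + 1)%nat ->
         rho j = (- (poch (alpha - 1) (2 * m + 1 - j) / factC (2 * m + 1 - j)))%C) /\
      rho m = (poch alpha (m + 1) / factC (m + 1) + poch alpha m / factC m)%C /\
      (forall j : nat, (j <= m - 1)%nat ->
         rho j = (poch (alpha - 1) (2 * m + 1 - j) / factC (2 * m + 1 - j))%C))).
Proof.
  split; [exists (conv_coef alpha m n); apply conv_coef_expansion, halpha|].
  intros rho hrho.
  assert (e : forall j, (j <= m + n + 1)%nat -> rho j = conv_coef alpha m n j).
  { apply (expansion_unique m n alpha); [exact halpha|exact hrho|].
    apply conv_coef_expansion, halpha. }
  split.
  (* Each clause fixes the position of j relative to m < n, which selects a single summand of
     [conv_coef], or none in the gap between m and n. *)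
  - intros hlt; repeat split; intros; rewrite e by lia; unfold conv_coef, kronecker;
      rewrite ?Nat.add_1_r;
      decide_comparisons; unfold binom_coef; ring.
  (* With n = m both Kronecker terms fire at j = m, whence the two-term value there. *)
  - intros ->; repeat split; intros; rewrite e by lia; unfold conv_coef, kronecker;
      replace (2 * m + 1)%nat with (m + m + 1)%nat by lia; rewrite ?Nat.add_1_r;
      decide_comparisons; unfold binom_coef; ring.
Qed.
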